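(* Let $S=\{s_1<\cdots<s_k\}$ be a $k$-subset of $\mathbf n$ with $k\ge1$ and let $d_S=\dim_F\langle v_S\rangle$. If $k=1$ then $d_S=s_1$, and for $k\ge2$ \[ d_S=\sum_{i=1}^{k-1}\binom{s_{k-i+1}}{k+1-i}\gamma_i-\sum_{i=1}^{k-1}\binom{s_{k-i+1}-s_1}{k+1-i}\gamma_i-\sum_{i=1}^{k-2}s_1\binom{s_{k-i+1}-s_2}{k-i}\gamma_i, \] where $\gamma_1=1$ and for $2\le j\le k-1$, $\gamma_j=-\sum_{i=1}^{j-2}\binom{s_{k+1-i}-s_{k+2-j}}{j-i}\gamma_i$.
   Context: $\mathbf n=\{1,\ldots,n\}$. $\mathcal{IC}_n$ is the monoid (under composition) of all injective partial maps $f$ from $D(f)\subseteq\mathbf n$ onto a subset of $\mathbf n$ that are order preserving ($a<b$ implies $f(a)<f(b)$) and order decreasing ($f(a)\le a$); the empty map is included. $F$ is a field of characteristic $0$; $V$ has $F$-basis $\{v_S:S\subseteq\mathbf n\}$ with $\mathcal{IC}_n$-action $f\cdot v_S=v_{f(S)}$ if $S\subseteq D(f)$ and $0$ otherwise; $\langle v_S\rangle$ is the submodule generated by $v_S$. Empty sums are $0$; $\binom{a}{b}=0$ for integers $0\le a<b$. *)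

(* Defs.v *)
From HB Require Import structures.
From mathcomp Require Import all_boot all_order all_algebra.

Set Implicit Arguments.
Unset Strict Implicit.
Unset Printing Implicit Defensive.

Import GRing.Theory.
Local Open Scope ring_scope.

(* The element [a : 'I_n] stands for the integer [a.+1] of {1, ..., n}; a
   partial map is a total one into [option], with [None] for "undefined". *)

Section ICMonoid.
Variable n : nat.

Definition pinjective (f : {ffun 'I_n -> option 'I_n}) : bool :=
  [forall a, forall b, (f a != None) && (f a == f b) ==> (a == b)].

Definition order_preserving (f : {ffun 'I_n -> option 'I_n}) : bool :=
  [forall a, forall b, forall c, forall d,
     [&& f a == Some c, f b == Some d & (a < b)%N] ==> (c < d)%N].

Definition order_decreasing (f : {ffun 'I_n -> option 'I_n}) : bool :=
  [forall a, forall c, (f a == Some c) ==> (c <= a)%N].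

Record IC := MkIC {
  IC_fun :> {ffun 'I_n -> option 'I_n};
  IC_prop :
    [&& pinjective IC_fun, order_preserving IC_fun & order_decreasing IC_fun] }.

HB.instance Definition _ := [isSub for IC_fun].
HB.instance Definition _ := [Finite of IC by <:].

Definition dom (f : IC) : {set 'I_n} := [set a | f a != None].

Definition img (f : IC) (S : {set 'I_n}) : {set 'I_n} :=
  [set c | [exists a in S, f a == Some c]].

Lemma ICP (f : {ffun 'I_n -> option 'I_n}) :
  reflect [/\ forall a b c, f a = Some c -> f b = Some c -> a = b,
              forall a b c d, f a = Some c -> f b = Some d ->
                (a < b)%N -> (c < d)%N
            & forall a c, f a = Some c -> (c <= a)%N]
    [&& pinjective f, order_preserving f & order_decreasing f].
Proof.
apply: (iffP and3P) => -[inj_f mono_f decr_f]; split.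
- move=> a b c fa fb; apply/eqP.
  by have /forallP/(_ b)/implyP := forallP inj_f a; apply; rewrite fa fb /=.
- move=> a b c d fa fb ab.
  have /forallP/(_ b)/forallP/(_ c)/forallP/(_ d)/implyP := forallP mono_f a.
  by apply; rewrite fa fb ab !eqxx.
- move=> a c fa; have /forallP/(_ c)/implyP := forallP decr_f a.
  by apply; rewrite fa.
- apply/forallP => a; apply/forallP => b; apply/implyP => /andP[].
  case fa: (f a) => [c|] // _ /eqP fb; apply/eqP.
  by apply: inj_f fa _; rewrite -fb.
- apply/forallP => a; apply/forallP => b; apply/forallP => c; apply/forallP => d.
  by apply/implyP => /and3P[/eqP fa /eqP fb ab]; apply: mono_f fa fb ab.
- apply/forallP => a; apply/forallP => c; apply/implyP => /eqP fa.
  exact: decr_f fa.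
Qed.

Fact IC_one_subproof (f := [ffun a : 'I_n => Some a]) :
  [&& pinjective f, order_preserving f & order_decreasing f].
Proof.
apply/ICP; split.
- by move=> a b c; rewrite !ffunE => -[->] [->].
- by move=> a b c d; rewrite !ffunE => -[->] [->].
- by move=> a c; rewrite ffunE => -[->].
Qed.

Definition IC_one : IC := MkIC IC_one_subproof.

Fact IC_mul_subproof (f g : IC) (h := [ffun a => obind f (g a)]) :
  [&& pinjective h, order_preserving h & order_decreasing h].
Proof.
have hP a c : h a = Some c -> exists2 b, g a = Some b & f b = Some c.
  by rewrite ffunE; case: (g a) => //= b; exists b.
have [injf monof decrf] := ICP f (IC_prop f).
have [injg monog decrg] := ICP g (IC_prop g).
apply/ICP; split.
- move=> a b c /hP[x ga fx] /hP[y gb fy].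
  by move: gb; rewrite -(injf _ _ _ fx fy) => /(injg _ _ _ ga).
- move=> a b c d /hP[x ga fx] /hP[y gb fy] ab.
  exact: monof fx fy (monog _ _ _ _ ga gb ab).
- by move=> a c /hP[x /decrg le_xa /decrf le_cx]; apply: leq_trans le_xa.
Qed.

(* [IC_mul f g] is "g first, then f", so that the action below is a left
   action. *)
Definition IC_mul (f g : IC) : IC := MkIC (IC_mul_subproof f g).

Lemma IC_ext (f g : IC) : (forall a, f a = g a) -> f = g.
Proof. by move=> eq_fg; apply/val_inj/ffunP. Qed.

Fact IC_mulA : associative IC_mul.
Proof.
move=> f g h; apply: IC_ext => a; rewrite !ffunE.
by case: (h a) => //= b; rewrite ffunE.
Qed.

Fact IC_mul1 : left_id IC_one IC_mul.
Proof.
by move=> f; apply: IC_ext => a; rewrite ffunE; case: (f a) => //= b; rewrite ffunE.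
Qed.

Fact IC_mulr1 : right_id IC_one IC_mul.
Proof. by move=> f; apply: IC_ext => a; rewrite !ffunE. Qed.

HB.instance Definition _ := isMonoid.Build IC IC_mulA IC_mul1 IC_mulr1.

End ICMonoid.

Section Module.
Variables (F : fieldType) (n : nat).

Definition V : vectType F := {ffun {set 'I_n} -> F^o}.

Definition v (S : {set 'I_n}) : V := [ffun T => (T == S)%:R].

Definition act (f : IC n) (u : V) : V :=
  \sum_(S : {set 'I_n}) u S *: (if S \subset dom f then v (img f S) else 0).

Definition is_submodule (U : {vspace V}) : Prop :=
  forall (f : IC n) (u : V), u \in U -> act f u \in U.

(* The span of the orbit of w; [gen_submodule_min] shows that it is the least
   submodule containing w. *)
Definition gen_submodule (w : V) : {vspace V} :=
  <<codom (act^~ w)>>%VS.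

Lemma v_expand (u : V) : u = \sum_(S : {set 'I_n}) u S *: v S.
Proof.
apply/ffunP => T; rewrite sum_ffunE (bigD1 T) //= big1 => [|S neST].
  by rewrite !ffunE eqxx addr0 /= [_ *: _]mulr1.
by rewrite !ffunE eq_sym (negPf neST) /= scaler0.
Qed.

Lemma v_basis : basis_of fullv (codom v).
Proof.
rewrite basisEdim size_codom dimvf /dim /= muln1 leqnn andbT.
apply/subvP => u _; rewrite (v_expand u); apply: memv_suml => S _.
by apply/memvZ/memv_span/codom_f.
Qed.

Fact act_is_linear f : linear (act f).
Proof.
move=> a u w; rewrite /act scaler_sumr -big_split /=; apply: eq_bigr => S _.
by rewrite !ffunE scalerDl scalerA.
Qed.

HB.instance Definition _ f :=
  GRing.isLinear.Build F V V *:%R (act f) (act_is_linear f).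

Lemma act_v f S : act f (v S) = if S \subset dom f then v (img f S) else 0.
Proof.
rewrite /act (bigD1 S) //= big1 => [|T neTS].
  by rewrite ffunE eqxx scale1r addr0.
by rewrite ffunE (negPf neTS) scale0r.
Qed.

Lemma act1 u : act 1%g u = u.
Proof.
rewrite [RHS](v_expand u) [act _ u]/act; apply: eq_bigr => S _.
have -> : S \subset dom (1%g : IC n).
  by apply/subsetP => a _; rewrite inE ffunE.
congr (_ *: v _); apply/setP => c; rewrite inE.
apply/existsP/idP => [[a /andP[aS]]|cS]; first by rewrite ffunE => /eqP[<-].
by exists c; rewrite cS ffunE /=.
Qed.

Lemma actM f g u : act (f * g)%g u = act f (act g u).
Proof.
have actE h : act h u = \sum_(S : {set 'I_n}) u S *: act h (v S).
  by apply: eq_bigr => S _; rewrite act_v.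
rewrite (actE g) linear_sum actE; apply: eq_bigr => S _.
rewrite linearZ /=; congr (_ *: _); rewrite !act_v.
have fgE a : (f * g)%g a = obind f (g a) by rewrite ffunE.
case: ifP => [sub_fg|nsub_fg]; case: ifP => [sub_g|nsub_g]; rewrite ?linear0 //.
- rewrite act_v ifT; last first.
    apply/subsetP => b; rewrite inE => /existsP[a /andP[aS /eqP ga]].
    by have := subsetP sub_fg a aS; rewrite !inE fgE ga.
  congr v; apply/setP => c; rewrite !inE.
  apply/existsP/existsP => [[a /andP[aS]]|[b /andP[]]].
    rewrite fgE; case ga: (g a) => [b|] //= fb; exists b; rewrite fb andbT inE.
    by apply/existsP; exists a; rewrite aS ga /=.
  rewrite inE => /existsP[a /andP[aS /eqP ga]] fb.
  by exists a; rewrite aS fgE ga.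
- case/negP: (negbT nsub_g); apply/subsetP => a aS; rewrite inE.
  by have := subsetP sub_fg a aS; rewrite inE fgE; case: (g a).
- rewrite act_v ifF //; apply/negbTE/negP => sub_f.
  case/negP: (negbT nsub_fg); apply/subsetP => a aS; rewrite inE fgE.
  have := subsetP sub_g a aS; rewrite inE; case ga: (g a) => [b|] //= _.
  have /(subsetP sub_f) : b \in img g S.
    by rewrite inE; apply/existsP; exists a; rewrite aS ga /=.
  by rewrite inE.
Qed.

Lemma gen_submodule_min w :
  [/\ w \in gen_submodule w, is_submodule (gen_submodule w)
    & forall U : {vspace V},
        w \in U -> is_submodule U -> (gen_submodule w <= U)%VS].
Proof.
have memg f : act f w \in gen_submodule w.
  exact/memv_span/(codom_f (act^~ w)).
split; first by rewrite -{1}[w]act1.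
  move=> f u /coord_span->; rewrite linear_sum; apply: memv_suml => i _.
  rewrite linearZ /=; apply: memvZ.
  set x := _`_i; have /codomP[g ->] : x \in codom (act^~ w).
    by apply: mem_nth; rewrite size_codom.
  by rewrite -actM.
by move=> U wU subU; apply/span_subvP => _ /codomP[f ->]; apply: subU.
Qed.

End Module.

(* [elt S i] is s_i when S = {s_1 < ... < s_k} and 1 <= i <= k. *)
Definition elt (n : nat) (S : {set 'I_n}) (i : nat) : nat :=
  nth 0%N [seq (val a).+1 | a <- enum S] i.-1.

Lemma elt_increasing n (S : {set 'I_n}) i j :
  (1 <= i)%N -> (i < j)%N -> (j <= #|S|)%N -> (elt S i < elt S j)%N.
Proof.
case: i j => [//|i] [//|j] _; rewrite ltnS => ltij jS.
have srt : sorted ltn [seq (val a).+1 | a <- enum S].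
  rewrite sorted_map /enum_mem; apply: sorted_filter.
    by move=> a b c; apply: ltn_trans.
  rewrite -enumT -(sorted_map (f := val) (e' := ltn)) val_enum_ord.
  exact: iota_ltn_sorted.
rewrite /elt /=; apply: (sorted_ltn_nth ltn_trans 0%N srt) => //;
  by rewrite inE size_map -cardE // (ltn_trans ltij).
Qed.

Lemma mem_elt n (S : {set 'I_n}) (a : 'I_n) :
  a \in S -> exists2 i, (1 <= i <= #|S|)%N & elt S i = a.+1.
Proof.
move=> aS; exists (index a (enum S)).+1.
  by rewrite /= cardE index_mem mem_enum.
by rewrite /elt /= (nth_map a) ?nth_index ?index_mem ?mem_enum.
Qed.

(* Main.v *)
(* The orbit of v_S consists of 0 and the v_T with |T| = k and t_i <= s_i for all
   i, so d_S = P_k, where P_j counts the j-sets T with t_i <= s_i for i <= j.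
   Sorting all m-subsets of {1, ..., s_m} by the first index j + 1 at which
   t_(j+1) > s_(j+1) gives
     C(s_m, m) = sum_(j <= m) P_j C(s_m - s_(j+1), m - j),
   a unitriangular linear system for the P_j.  The gamma_i are the coefficients
   that combine its equations m = k + 1 - i so as to eliminate
   P_2, ..., P_(k-1); what remains involves only P_k, P_0 = 1 and P_1 = s_1. *)
Require Import Defs.
From HB Require Import structures.
From mathcomp Require Import all_boot all_order all_algebra.
From mathcomp Require Import zify ring.

Set Implicit Arguments.
Unset Strict Implicit.
Unset Printing Implicit Defensive.

Import GRing.Theory.
Local Open Scope ring_scope.

(** * Ranks of elements in a subset *)

(** For [a] in [T] this is the position of [a], counted from 1. Being a count, it is easily compared
    across order embeddings. *)
Definition rank n (T : {set 'I_n}) (a : 'I_n) : nat :=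
  #|[set b in T | (b <= a)%N]|.

Lemma leq_rank n (T : {set 'I_n}) (a b : 'I_n) :
  (a <= b)%N -> (rank T a <= rank T b)%N.
Proof.
move=> ab; apply/subset_leq_card/subsetP => c; rewrite !inE => /andP[-> ca].
exact: leq_trans ca ab.
Qed.

Lemma ltn_rank n (T : {set 'I_n}) (a b : 'I_n) :
  b \in T -> (a < b)%N -> (rank T a < rank T b)%N.
Proof.
move=> bT ab; apply/proper_card/properP; split.
  apply/subsetP => c; rewrite !inE => /andP[-> ca].
  by rewrite (leq_trans ca) // ltnW.
by exists b; rewrite !inE bT ?leqnn //= -ltnNge.
Qed.

Lemma rank_inj n (T : {set 'I_n}) : {in T &, injective (rank T)}.
Proof.
move=> a b aT bT eq_ab; apply/val_inj => /=.
by case: (ltngtP a b) => // /ltn_rank lt_ab; [have := lt_ab _ bT | have := lt_ab _ aT];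
  rewrite eq_ab ltnn.
Qed.

(** In a strictly increasing list exactly i + 1 entries are at most the entry of index i. This ties
    ranks to the enumeration behind [elt]. *)
Lemma rank_index n (T : {set 'I_n}) (a : 'I_n) :
  a \in T -> rank T a = (index a (enum T)).+1.
Proof.
move=> aT; have srt : sorted <%O [seq val b | b <- enum T].
  rewrite sorted_map /enum_mem; apply: sorted_filter.
    by move=> x y z; apply: ltn_trans.
  rewrite -enumT -(sorted_map (f := val) (e' := ltn)) val_enum_ord.
  exact: iota_ltn_sorted.
have ltT : (index a (enum T) < size (enum T))%N by rewrite index_mem mem_enum.
have := Order.POrderTheory.count_le_nth 0%N srt (i := index a (enum T)).
rewrite size_map => /(_ ltT) <-.
rewrite (nth_map a) // nth_index ?mem_enum // count_map /rank cardE -size_filter.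
apply/perm_size/uniq_perm => [||b]; first exact: enum_uniq.
  exact/filter_uniq/enum_uniq.
by rewrite mem_enum inE mem_filter mem_enum andbC.
Qed.

Lemma rank_onto n (T : {set 'I_n}) i :
  (0 < i <= #|T|)%N -> exists2 a, a \in T & rank T a = i.
Proof.
case: i => // i /= lt_i; have a0 : 'I_n.
  by move: lt_i; case: (set_0Vmem T) => [->|[a _] //]; rewrite cards0.
have sz : (i < size (enum T))%N by rewrite -cardE.
have inT : nth a0 (enum T) i \in T by rewrite -mem_enum mem_nth.
by exists (nth a0 (enum T) i); rewrite // rank_index // index_uniq ?enum_uniq.
Qed.

Lemma rank_bounds n (T : {set 'I_n}) a : a \in T -> (0 < rank T a <= #|T|)%N.
Proof.
move=> aT; apply/andP; split; last by apply/subset_leq_card/subsetP => b /setIdP[].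
by apply/card_gt0P; exists a; rewrite !inE aT /=.
Qed.

Lemma elt_rank n (S : {set 'I_n}) (a : 'I_n) : a \in S -> elt S (rank S a) = a.+1.
Proof.
move=> aS; rewrite rank_index // /elt /=.
by rewrite (nth_map a) ?nth_index ?index_mem ?mem_enum.
Qed.

Lemma elt_le n (S : {set 'I_n}) i : (elt S i <= n)%N.
Proof.
rewrite /elt; have [lt_i|] := ltnP i.-1 (size [seq (val a).+1 | a <- enum S]).
  by have /mapP[a _ ->] := mem_nth 0%N lt_i; apply: ltn_ord.
by move/(nth_default 0%N) ->.
Qed.

(** * The orbit of a basis vector *)

(* Subsets of {1, ..., x} with elements t_1 < ... < t_m satisfying t_i <= s i. *)
Definition dominated n (s : nat -> nat) (m x : nat) : {set {set 'I_n}} :=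
  [set T : {set 'I_n} | (#|T| == m) && [forall a in T, (a < x)%N && (a < s (rank T a))%N]].

Lemma dominatedP n s m x (T : {set 'I_n}) :
  reflect (#|T| = m /\ forall a, a \in T -> (a < x)%N /\ (a < s (rank T a))%N)
          (T \in dominated n s m x).
Proof.
rewrite inE; apply: (iffP andP) => -[/eqP cT domT]; split=> //.
  by move=> a aT; apply/andP; have /implyP := forallP domT a; apply.
by apply/forallP => a; apply/implyP => aT; apply/andP/domT.
Qed.

(** On [S] the map [f] is an order embedding, so it preserves ranks; being order decreasing, it then
    gives t_i <= s_i. *)
Lemma orbit_dominated n (S : {set 'I_n}) (f : IC n) :
  S \subset dom f -> img f S \in dominated n (elt S) #|S| n.
Proof.
move=> /subsetP subf; have [injf monof decrf] := ICP f (IC_prop f).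
pose g a := odflt a (f a).
have fg a : a \in S -> f a = Some (g a).
  by move=> /subf; rewrite inE /g; case: (f a).
have imgE : img f S = g @: S.
  apply/setP => c; rewrite inE; apply/existsP/imsetP => [[a]|[a aS ->]].
    by case/andP => aS; rewrite fg // => /eqP[<-]; exists a.
  by exists a; rewrite aS fg /=.
have mono_g : {in S &, {mono g : a b / (a <= b)%N}}.
  move=> a b aS bS; have [ab|ba] := leqP a b; last first.
    by apply/negbTE; rewrite -ltnNge; apply: monof (fg _ bS) (fg _ aS) ba.
  move: ab; rewrite leq_eqVlt => /orP[/eqP/val_inj->|ab]; first exact: leqnn.
  by apply: ltnW; apply: monof (fg _ aS) (fg _ bS) ab.
have inj_g : {in S &, injective g}.
  by move=> a b aS bS eq_g; apply: injf (fg _ aS) _; rewrite eq_g fg.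
apply/dominatedP; rewrite imgE card_in_imset //; split=> // _ /imsetP[a aS ->].
split=> //; suff -> : rank (g @: S) (g a) = rank S a.
  by rewrite elt_rank // ltnS; apply: decrf; apply: fg.
rewrite /rank; have sub : [set b in S | (b <= a)%N] \subset S.
  by apply/subsetP => b /setIdP[].
rewrite -(@card_in_imset _ _ g [set b in S | (b <= a)%N]); last first.
  by move=> b c /(subsetP sub) bS /(subsetP sub) cS; apply: inj_g.
apply: eq_card => c; rewrite inE; apply/andP/imsetP => [[/imsetP[b bS ->]]|[b]].
  by rewrite mono_g // => ba; exists b; rewrite // inE bS.
by case/setIdP => bS ba ->; rewrite imset_f // mono_g.
Qed.

(** The witness sends the element of rank i in [S] to the element of rank i in [T] and is undefined
    outside [S]. Domination makes it order decreasing. *)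
Lemma dominated_orbit n (S T : {set 'I_n}) :
  T \in dominated n (elt S) #|S| n ->
  exists2 f : IC n, S \subset dom f & img f S = T.
Proof.
case/dominatedP => cardT domT.
pose h : {ffun 'I_n -> option 'I_n} :=
  [ffun a => if a \in S then [pick c in T | rank T c == rank S a] else None].
have hP a c : h a = Some c -> [/\ a \in S, c \in T & rank T c = rank S a].
  by rewrite ffunE; case: ifP => // aS; case: pickP => // d /andP[dT /eqP rd] [<-].
have hS a : a \in S -> exists c, h a = Some c.
  move=> aS; rewrite ffunE aS; case: pickP => [c|noc]; first by exists c.
  have /rank_onto[c cT rc] : (0 < rank S a <= #|T|)%N by rewrite cardT rank_bounds.
  by have := noc c; rewrite /= cT rc eqxx.
have h_IC : [&& pinjective h, order_preserving h & order_decreasing h].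
  apply/ICP; split.
  - move=> a b c /hP[aS _ rca] /hP[bS _ rcb].
    by apply: rank_inj aS bS _; rewrite -rca.
  - move=> a b c d /hP[aS _ rca] /hP[bS _ rdb] ab.
    rewrite ltnNge; apply/negP => /(leq_rank T).
    by rewrite rca rdb leqNgt ltn_rank.
  - move=> a c /hP[aS cT rca]; have [_] := domT c cT.
    by rewrite rca elt_rank.
exists (MkIC h_IC); first by apply/subsetP => a /hS[c ha]; rewrite inE ha.
apply/setP => c; rewrite inE; apply/existsP/idP => [[a /andP[_ /eqP ha]]|cT].
  by case: (hP a c ha).
have /rank_onto[a aS ra] : (0 < rank T c <= #|S|)%N by rewrite -cardT rank_bounds.
exists a; rewrite aS /=; have [d hd] := hS a aS; rewrite hd.
have [_ dT rd] := hP _ _ hd.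
by apply/eqP; congr Some; apply: rank_inj dT cT _; rewrite rd ra.
Qed.

(** The nonzero orbit vectors are distinct basis vectors, indexed by the dominated sets. *)
Lemma dim_gen_submodule (F : fieldType) n (S : {set 'I_n}) :
  \dim (gen_submodule (v F S)) = #|dominated n (elt S) #|S| n|.
Proof.
set A := dominated _ _ _ _.
have -> : gen_submodule (v F S) = <<[seq v F T | T in A]>>%VS.
  apply: subv_anti; apply/andP; split; apply/span_subvP.
    move=> _ /codomP[f ->]; rewrite act_v; case: ifP => [Sf|_]; last exact: mem0v.
    by apply/memv_span/image_f/orbit_dominated.
  move=> _ /imageP[T /dominated_orbit[f Sf <-] ->].
  by apply/memv_span/codomP; exists f; rewrite act_v Sf.
have : free [seq v F T | T in A].
  (* Listing [A] before its complement permutes the basis, so the vectors of [A] form a free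
     prefix. *)
  have : free [seq v F T | T <- enum A ++ enum (~: A)].
    rewrite (@perm_free _ _ _ (codom (v F (n:=n)))) ?(basis_free (v_basis F n)) //.
    apply/perm_map/uniq_perm; rewrite ?enum_uniq //.
      rewrite cat_uniq !enum_uniq andbT /=; apply/hasPn => T.
      by rewrite !mem_enum inE.
    by move=> T; rewrite mem_cat !mem_enum !inE orbN.
  by rewrite map_cat => /catl_free.
by rewrite /free size_map -cardE => /eqP.
Qed.

(** * Counting dominated sets *)

Lemma card_dominated0 n s x : #|dominated n s 0 x| = 1%N.
Proof.
rewrite -(cards1 (set0 : {set 'I_n})); apply: eq_card => T; rewrite in_set1.
apply/dominatedP/eqP => [[/cards0_eq //]|->]; rewrite cards0; split=> // a.
by rewrite inE.
Qed.

Lemma card_dominatedS0 n s m : #|dominated n s m.+1 0| = 0%N.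
Proof.
apply: eq_card0 => T; apply/negP => /dominatedP[cT domT].
have /card_gt0P[a /domT[]] : (0 < #|T|)%N by rewrite cT.
by rewrite ltn0.
Qed.

Lemma rank_setU1 n (T : {set 'I_n}) (i a : 'I_n) :
  (a < i)%N -> rank (i |: T) a = rank T a.
Proof.
move=> ai; apply: eq_card => b; rewrite !inE; case: eqP => //= ->.
by rewrite leqNgt ai andbF.
Qed.

(* Split according to whether x + 1 belongs to the set, necessarily as its last
   element. *)
Lemma card_dominatedSS n s m x : (x < n)%N ->
  #|dominated n s m.+1 x.+1| =
    (#|dominated n s m.+1 x| + (if x < s m.+1 then #|dominated n s m x| else 0))%N.
Proof.
move=> xn; pose i := Ordinal xn.
rewrite -(cardsID [set T : {set 'I_n} | i \in T]) addnC; congr (_ + _)%N.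
  apply: eq_card => T; rewrite in_setD [in X in ~~ X]inE.
  apply/andP/dominatedP => [[iT /dominatedP[cT domT]]|[cT domT]].
    split=> // a aT; have [ax ->] := domT a aT; split=> //.
    rewrite ltn_neqAle -ltnS ax andbT; apply: contraNneq iT => ax'.
    by rewrite (_ : i = a) //; apply/val_inj.
  split; first by apply/negP => /domT[]; rewrite ltnn.
  by apply/dominatedP; split=> // a /domT[ax ->]; split=> //; apply: ltnW.
have notin T : T \in dominated n s m x -> i \notin T.
  by case/dominatedP => _ domT; apply/negP => /domT[]; rewrite ltnn.
have rank_i (T : {set 'I_n}) : (forall a, a \in T -> (a < x.+1)%N) -> rank T i = #|T|.
  move=> leT; apply: eq_card => b; rewrite inE; case bT: (b \in T) => //=.
  exact: leT.
(* As last element, x + 1 has rank m + 1, which is allowed only if x < s (m + 1). *)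
have [xs|sx] := ltnP x (s m.+1); last first.
  apply: eq_card0 => T; rewrite !inE; apply/negP => /andP[/andP[/eqP cT domT] iT].
  have domT' a : a \in T -> (a < x.+1)%N && (a < s (rank T a))%N.
    by move=> aT; have /implyP := forallP domT a; apply.
  have /andP[_] := domT' i iT.
  by rewrite rank_i ?cT ?ltnNge ?sx // => a /domT' /andP[].
rewrite -(@card_in_imset _ _ (fun T => i |: T) (dominated n s m x)); last first.
  by move=> T U /notin iT /notin iU eqTU; rewrite -(setU1K iT) eqTU setU1K.
apply: eq_card => T; rewrite in_setI inE.
apply/andP/imsetP => [[/dominatedP[cT domT] iT]|[U domU ->]].
  exists (T :\ i); last by rewrite setD1K.
  have domT' a : a \in T :\ i -> (a < x)%N.
    rewrite !inE => /andP[ai /domT[ax _]]; rewrite ltn_neqAle -ltnS ax andbT.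
    by apply: contraNneq ai => ax'; apply/eqP/val_inj.
  apply/dominatedP; split; first by apply/eqP; rewrite -eqSS -cT (cardsD1 i T) iT.
  move=> a aT; have ax := domT' a aT; split=> //.
  move: aT; rewrite inE => /andP[_ /domT[_]].
  by rewrite -{1}(setD1K iT) rank_setU1.
have iU := notin _ domU; have [cU dU] := elimT (dominatedP _ _ _ _) domU.
split; last by rewrite setU11.
have cT : #|i |: U| = m.+1 by rewrite cardsU1 iU cU.
have leT a : a \in i |: U -> (a < x.+1)%N.
  by case/setU1P => [-> //|/dU[/ltnW]].
apply/dominatedP; split=> // a aT; split; first exact: leT.
case/setU1P: aT => [->|aU]; first by rewrite rank_i // cT.
by have [ax ?] := dU a aU; rewrite rank_setU1.
Qed.

(** For m > 0 the last element has rank m, so it is at most [s m], and raising x further adds no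
    set. *)
Lemma card_dominated_stable n s m x : (s m <= x <= n)%N ->
  #|dominated n s m x| = #|dominated n s m (s m)|.
Proof.
case: m => [|m]; first by rewrite !card_dominated0.
elim: x => [|x IH] /andP[]; first by rewrite leqn0 => /eqP->.
rewrite leq_eqVlt => /orP[/eqP-> //|sx xn].
by rewrite card_dominatedSS // ltnNge -ltnS sx addn0 IH // -ltnS sx ltnW.
Qed.

(* Sort the m-subsets of {1, ..., x} by the first index j + 1 at which
   t_(j + 1) > s (j + 1). *)
Lemma bin_dominated n s m x : {in [pred i | 0 < i < m]%N, forall i, s i <= s i.+1}%N ->
  (x <= n)%N ->
  'C(x, m) = (#|dominated n s m x| +
    \sum_(0 <= j < m) #|dominated n s j (s j)| * 'C(x - s j.+1, m - j))%N.
Proof.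
elim: m x => [|m IHm] x mono_s; first by rewrite bin0 card_dominated0 big_geq.
elim: x => [|x IHx] xn.
  rewrite card_dominatedS0 big1_seq // => j /=; rewrite mem_index_iota => jm.
  by rewrite sub0n subSn // bin0n muln0.
have mono_s' : {in [pred i | 0 < i < m]%N, forall i, s i <= s i.+1}%N.
  by move=> i /andP[i0 im]; apply: mono_s; rewrite inE i0 ltnW.
rewrite binS IHx 1?ltnW // (IHm x mono_s') 1?ltnW // card_dominatedSS //.
rewrite !(big_nat_recr m) //= !subSnn !bin1.
(* Pascal's rule in each term; when x < s (j + 1) both sides vanish because m - j > 0. *)
have -> : (\sum_(0 <= j < m) #|dominated n s j (s j)| * 'C(x.+1 - s j.+1, m.+1 - j) =
   \sum_(0 <= j < m) #|dominated n s j (s j)| * 'C(x - s j.+1, m.+1 - j) +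
   \sum_(0 <= j < m) #|dominated n s j (s j)| * 'C(x - s j.+1, m - j))%N.
  rewrite -big_split; apply: eq_big_nat => j /= jm; rewrite -mulnDr; congr muln.
  rewrite (subSn (ltnW jm)); have [sx|xs] := leqP (s j.+1) x; first by rewrite subSn ?binS.
  rewrite (eqP xs) (eqP (ltnW xs)) !bin0n.
  by case: (m - j)%N (subn_gt0 j m) => //; rewrite jm.
have [xs|sx] := ltnP x (s m.+1).
  by rewrite (eqP xs) (eqP (ltnW xs)) !muln0 !addn0 addnACA.
(* Now the factor x - s (m + 1) of the term j = m grows by one, so the sum gains the count at [s m].
   Stability identifies it with the count at x. *)
have -> : #|dominated n s m x| = #|dominated n s m (s m)|.
  case: m mono_s sx {IHm IHx mono_s'} => [|m] mono_s sx.
    by rewrite !card_dominated0.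
  apply: card_dominated_stable; apply/andP; split; last exact: ltnW.
  by apply: leq_trans sx; apply: mono_s; rewrite inE /=.
rewrite subSn // mulnS addn0 -!addnA; do 2!congr (_ + _)%N.
by rewrite [RHS]addnC -addnA addnCA.
Qed.

(** * Elimination in the triangular system *)

(** Numbering the equations by m = k + 1 - i and the unknowns by l = k + 1 - j gives a unitriangular
    matrix [A]. The row combination with weights [gamma] has coefficient 1 at j = 1 and 0 at every
    other j, which isolates P k. *)
Lemma solve_bin_system (k : nat) (s : nat -> nat) (P gamma : nat -> int) :
  (2 <= k)%N -> P 0%N = 1 -> P 1%N = (s 1%N)%:Z ->
  (forall m, (m <= k)%N -> 'C(s m, m)%:Z =
     \sum_(0 <= l < m.+1) P l * 'C(s m - s l.+1, m - l)%:Z) ->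
  gamma 1%N = 1 ->
  (forall j : nat, (2 <= j <= k - 1)%N ->
     gamma j = - \sum_(1 <= i < (j - 2).+1)
       'C(s (k + 1 - i)%N - s (k + 2 - j)%N, j - i)%:Z * gamma i) ->
  P k =
      \sum_(1 <= i < (k - 1).+1) 'C(s (k - i + 1)%N, k + 1 - i)%:Z * gamma i
    - \sum_(1 <= i < (k - 1).+1) 'C(s (k - i + 1)%N - s 1%N, k + 1 - i)%:Z * gamma i
    - \sum_(1 <= i < (k - 2).+1)
         (s 1%N)%:Z * 'C(s (k - i + 1)%N - s 2%N, k - i)%:Z * gamma i.
Proof.
move=> k2 P0 P1 P_rec gamma_1 gamma_rec.
pose A i j := 'C(s (k + 1 - i)%N - s (k + 2 - j)%N, j - i)%:Z.
(* The known terms l = 0 and l = 1 move to the left; the others are reindexed by l = k + 1 - j. *)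
have rowE i : (1 <= i < k)%N ->
    'C(s (k - i + 1)%N, k + 1 - i)%:Z - 'C(s (k - i + 1)%N - s 1%N, k + 1 - i)%:Z
    - (s 1%N)%:Z * 'C(s (k - i + 1)%N - s 2%N, k - i)%:Z =
    \sum_(i <= j < k) P (k + 1 - j)%N * A i j.
  move=> /andP[i1 ik]; have -> : (k - i + 1 = k + 1 - i)%N by lia.
  rewrite P_rec; last by lia.
  rewrite big_ltn // big_ltn; last by lia.
  rewrite P0 P1 subn0 mul1r (_ : k + 1 - i - 1 = k - i)%N; last by lia.
  have cancel (x y z : int) : x + (y + z) - x - y = z by ring.
  rewrite cancel.
  rewrite -[2%N]add0n big_addn -[X in \sum_(X <= _ < k) _]add0n big_addn.
  rewrite [RHS]big_nat_rev (_ : ((k + 1 - i).+1 - 2 = k - i)%N); last by lia.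
  apply: eq_big_nat => l /andP[_ lt_l]; rewrite /A.
  by congr (P _ * Posz 'C(s _ - s _, _)); lia.
have colE j : (1 <= j < k)%N -> \sum_(1 <= i < j.+1) A i j * gamma i = (j == 1%N)%:R.
  case/andP => j1 jk; rewrite big_nat_recr //= {2}/A subnn bin0 mul1r.
  have [->|j1'] := eqVneq j 1%N; first by rewrite big_geq // gamma_1 add0r.
  (* The recurrence stops at i = j - 2 because the entry at i = j - 1 is C(0, 1) = 0. *)
  case: j j1 jk j1' => [|[|j]] // _ jk _; rewrite gamma_rec; last by lia.
  rewrite big_nat_recr //= {2}/A (_ : k + 1 - j.+1 = k + 2 - j.+2)%N; last by lia.
  by rewrite subnn subSnn mul0r addr0 !subSS subn0 subrr.
(* The added term i = k - 1 contains C(s 2 - s 2, 1) = 0. *)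
have -> : \sum_(1 <= i < (k - 2).+1) (s 1%N)%:Z * 'C(s (k - i + 1)%N - s 2%N, k - i)%:Z * gamma i
  = \sum_(1 <= i < (k - 1).+1) (s 1%N)%:Z * 'C(s (k - i + 1)%N - s 2%N, k - i)%:Z * gamma i.
  rewrite (_ : k - 1 = (k - 2).+1)%N; last by lia.
  rewrite [RHS]big_nat_recr //= (_ : k - (k - 2).+1 = 1)%N; last by lia.
  by rewrite subnn /= mulr0 mul0r addr0.
rewrite -!sumrB (_ : (k - 1).+1 = k); last by lia.
under eq_big_nat => i ik do rewrite -!mulrBl rowE // mulr_suml.
under eq_big_nat => i /andP[i1 _] do rewrite (big_nat_widenl _ 1%N) //.
rewrite (exchange_big_dep_nat xpredT) //=.
transitivity (\sum_(1 <= j < k) P (k + 1 - j)%N * (j == 1%N)%:R).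
  rewrite big_ltn // eqxx mulr1 addnK big1_seq ?addr0 // => j /=.
  by rewrite mem_index_iota; case: eqP => [->|_] //; rewrite mulr0.
apply: eq_big_nat => j jk; rewrite -colE // mulr_sumr.
rewrite (big_nat_widen 1 j.+1 k); last by case/andP: jk.
by apply: eq_big => [i|i _] /=; rewrite ?ltnS ?mulrA.
Qed.

(* All subtractions of natural numbers below have a nonnegative true value, so
   truncation never occurs. *)
Theorem theorem4p6 (F : fieldType) (n k : nat) (S : {set 'I_n})
    (gamma : nat -> int)
    (char0 : [pchar F] =i pred0)
    (k_ge1 : (1 <= k)%N) (cardS : #|S| = k)
    (gamma_1 : gamma 1%N = 1)
    (gamma_rec : forall j : nat, (2 <= j <= k - 1)%N ->
       gamma j = - \sum_(1 <= i < (j - 2).+1)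
         'C(elt S (k + 1 - i) - elt S (k + 2 - j), j - i)%:Z * gamma i) :
  (k = 1%N -> \dim (gen_submodule (v F S)) = elt S 1) /\
  ((2 <= k)%N ->
    (\dim (gen_submodule (v F S)))%:Z =
      \sum_(1 <= i < (k - 1).+1)
         'C(elt S (k - i + 1), k + 1 - i)%:Z * gamma i
    - \sum_(1 <= i < (k - 1).+1)
         'C(elt S (k - i + 1) - elt S 1, k + 1 - i)%:Z * gamma i
    - \sum_(1 <= i < (k - 2).+1)
         (elt S 1)%:Z * 'C(elt S (k - i + 1) - elt S 2, k - i)%:Z * gamma i).
Proof.
pose P j := #|dominated n (elt S) j (elt S j)|.
have dimE : \dim (gen_submodule (v F S)) = P k.
  by rewrite dim_gen_submodule cardS card_dominated_stable // elt_le leqnn.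
(* The term l = m is [P m], its binomial having lower index 0; for m = k it involves the default
   value 0 of [elt S k.+1]. *)
have P_rec m : (m <= k)%N -> 'C(elt S m, m) =
    (\sum_(0 <= l < m.+1) P l * 'C(elt S m - elt S l.+1, m - l))%N.
  move=> mk; rewrite big_nat_recr //= subnn bin0 muln1 addnC.
  apply: bin_dominated (elt_le _ _) => i /andP[i0 im].
  by apply/ltnW/elt_increasing => //; rewrite cardS (leq_trans im).
have P0 : P 0%N = 1%N by apply: card_dominated0.
have P1 : P 1%N = elt S 1.
  have := P_rec 1%N k_ge1; rewrite big_nat_recr // big_nat1 /= bin1 !subnn.
  by rewrite bin0 muln1 muln0 => ->.
rewrite dimE; split=> [->|k2] //.
apply: (solve_bin_system (P := fun j => (P j)%:Z)) => //; first by rewrite P0.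
- by rewrite P1.
- move=> m /P_rec ->; rewrite -natz natr_sum; apply: eq_bigr => l _.
  by rewrite natz PoszM.
Qed.
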